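(* For every integer $n\ge 5$, the boxicity of the Kneser graph $\mathrm{KG}(n,2)$ equals $n-2$. In particular, the boxicity of the Petersen graph $\mathrm{KG}(5,2)$ is $3$.
   Context: For integers $n\ge 2k+1$, the Kneser graph $\mathrm{KG}(n,k)$ has as vertices the $k$-element subsets of $\{1,\dots,n\}$, two vertices being adjacent iff the corresponding sets are disjoint. The boxicity $\mathrm{box}(G)$ of a graph $G$ is the minimum $d\ge 0$ such that $G$ is the intersection graph of a family of axis-parallel boxes $I_1\times\cdots\times I_d$ in $\mathbb{R}^d$ (each $I_j$ a closed real interval), one box per vertex, two distinct vertices adjacent iff their boxes intersect; complete graphs have boxicity $0$. *)

(* Defs.v *)
From HB Require Import structures.
From mathcomp Require Import all_boot all_order all_algebra.
From mathcomp Require Import boolp classical_sets reals.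

Set Implicit Arguments.
Unset Strict Implicit.
Unset Printing Implicit Defensive.

Import Order.TTheory GRing.Theory Num.Theory.
Local Open Scope ring_scope.
Local Open Scope classical_set_scope.

Record sgraph := SGraph {
  vertex :> finType;
  adj : rel vertex;
  adj_sym : symmetric adj;
  adj_irr : irreflexive adj }.

Definition ksubset (n k : nat) := {A : {set 'I_n} | #|A| == k}.

(* The condition [A != B] only matters for k = 0, where it removes the loop at
   the empty set. *)
Definition kneser_adj (n k : nat) : rel (ksubset n k) :=
  fun A B => (A != B) && [disjoint val A & val B].

Lemma kneser_adj_sym (n k : nat) : symmetric (@kneser_adj n k).
Proof. by move=> A B; rewrite /kneser_adj /= eq_sym disjoint_sym. Qed.

Lemma kneser_adj_irr (n k : nat) : irreflexive (@kneser_adj n k).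
Proof. by move=> A; rewrite /kneser_adj /= eqxx. Qed.

Definition kneser (n k : nat) : sgraph :=
  SGraph (@kneser_adj_sym n k) (@kneser_adj_irr n k).

Definition box (R : realType) (d : nat) (a b : 'rV[R]_d) : set 'rV[R]_d :=
  [set x : 'rV[R]_d | forall j, a 0 j <= x 0 j <= b 0 j].

(* For d = 0 every box is the one-point space R^0, so any two boxes meet: the
   graphs representable in dimension 0 are exactly the complete graphs. *)
Definition box_representable (R : realType) (G : sgraph) (d : nat) : Prop :=
  exists a b : G -> 'rV[R]_d,
    (forall v j, a v 0 j <= b v 0 j) /\
    (forall u v : G, u != v ->
       adj u v <-> box (a u) (b u) `&` box (a v) (b v) !=set0).

(* One coordinate per ordered pair (p, q) of vertices: if p and q are distinct
   and nonadjacent, p gets [0, 0], q gets [1, 1] and every other vertex gets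
   [0, 1]; otherwise every vertex gets [0, 1]. *)
Lemma box_representable_ex (R : realType) (G : sgraph) :
  exists d, `[< box_representable R G d >].
Proof.
exists #|{: G * G}|; apply/asboolP.
pose bad (w : G * G) := (w.1 != w.2) && ~~ adj w.1 w.2.
pose P j : G * G := @enum_val (G * G)%type predT j.
exists (fun v => \row_j (bad (P j) && (v == (P j).2))%:R).
exists (fun v => \row_j (~~ (bad (P j) && (v == (P j).1)))%:R).
split=> [v j|u v uv].
  rewrite !mxE ler_nat; case: (boolP (bad (P j))) => //= /andP[pq _].
  by case: eqP => //= ->; rewrite eq_sym pq.
split=> [e|[x [xu xv]]].
  exists (\row_j ((bad (P j)) && ((u == (P j).2) || (v == (P j).2)))%:R).
  split=> j; rewrite !mxE !ler_nat;
    case: (boolP (bad (P j))) => //= /andP[pq npq].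
    case: (eqVneq u (P j).2) => [->|_] /=; first by rewrite eq_sym pq.
    case: (eqVneq u (P j).1) => [up|_] /=; last by case: (_ == _).
    by case: eqP => //= vq; move: npq; rewrite -up -vq e.
  case: (eqVneq v (P j).2) => [->|_] /=.
    by rewrite orbT [_ == (P j).1]eq_sym pq.
  rewrite orbF; case: (eqVneq v (P j).1) => [vp|_] /=; last by case: (_ == _).
  by case: eqP => //= uq; move: npq; rewrite -vp -uq adj_sym e.
apply/negPn/negP => ne.
have bw : bad (u, v) by rewrite /bad /= uv.
have Pj : P (enum_rank (u, v)) = (u, v) by rewrite /P enum_rankK.
have := xu (enum_rank (u, v)); have := xv (enum_rank (u, v)).
rewrite !mxE Pj bw /= !eqxx /= => /andP[h1 _] /andP[_ h0].
by have := le_trans h1 h0; rewrite ler10.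
Qed.

Definition boxicity (R : realType) (G : sgraph) : nat :=
  ex_minn (box_representable_ex R G).

(* Main.v *)
Require Import Defs.
From mathcomp Require Import all_boot all_order all_algebra zify.
From mathcomp Require Import boolp reals.

Set Implicit Arguments.
Unset Strict Implicit.
Unset Printing Implicit Defensive.

Import Order.TTheory Num.Theory.

(** Vertices of KG(n,2) are edges of K_n, and its non-edges are the cherries
    {xa, xb}. A coordinate of a box representation is an interval order on the
    edges of K_n in which disjoint edges are incomparable, and every cherry must
    be separated by some coordinate.

    Upper bound: for each vertex v other than two fixed ones, order the edges at
    v as points by their other vertex, with the fixed vertices at the two ends;
    an edge avoiding v meets all these points except its own fixed vertices.

    Lower bound: suppose that n - 3 coordinates suffice. Cover the cherries
    centred at x that a coordinate separates by stars {xa, x*}, of weight 2, and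
    single cherries, of weight 1. All pairs of neighbours of x must be covered
    and C(t,2) >= 2t - 3, so the weights at x add up to at least 2n - 5 over all
    coordinates. Comparing with the first edge cp and the last edge cq of the
    order shows that a coordinate has weight at most 6 outside a centre c, unless
    it is an exceptional one of total weight at most 13. At least three vertices,
    plus one for each exceptional coordinate, are not centres; summing over them
    gives a contradiction for n >= 6. For n = 5 both coordinates must be
    exceptional, and then each of them has weight at most 7 outside a centre. *)

Lemma exists_notin (T : finType) (s : seq T) : size s < #|T| -> exists x, x \notin s.
Proof.
move=> sT; have /subsetPn[x _ xs] : ~~ (T \subset s); last by exists x.
by apply: contraL sT => /subset_leq_card Ts; rewrite -leqNgt (leq_trans Ts) ?card_size.
Qed.

Lemma sum_count_fibers (T : Type) (V : finType) (Q : pred V) (f : T -> V) (s : seq T) :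
  \sum_(x | Q x) count (fun i => f i == x) s = count (fun i => Q (f i)) s.
Proof.
rewrite -sum1_count (partition_big f Q) //=; apply: eq_bigr => x Qx.
by rewrite -sum1_count; apply: eq_bigl => i; case: eqP => [->|]; rewrite ?Qx ?andbF.
Qed.

Lemma leq_sum_sub (I : finType) (P Q : pred I) (F : I -> nat) :
  (forall i, P i -> Q i) -> \sum_(i | P i) F i <= \sum_(i | Q i) F i.
Proof. by apply: sub_le_big => // m n; apply: leq_addr. Qed.

Lemma leq_card_bigcup (I T : finType) (P : pred I) (A : I -> {set T}) :
  #|\bigcup_(i | P i) A i| <= \sum_(i | P i) #|A i|.
Proof.
elim/big_rec2: _ => [|i m B _ Bm]; first by rewrite cards0.
by rewrite (leq_trans (leq_card_setU _ _)) // leq_add2l.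
Qed.

(* Equivalent to [0 <= (t - 2) * (t - 3)]. *)
Lemma double_leq_bin2 t : 2 * t <= 'C(t, 2) + 3.
Proof. by elim: t => // t IHt; rewrite binS bin1; case: t IHt => [|[|t]]; lia. Qed.

(** * Weighted covers of cherries *)

Section WeightCovers.

Variable V : finType.
Implicit Types (s : rel V) (om : V -> nat).

Definition weight_cover s k := exists (S : {set V}) (E : {set {set V}}),
  2 * #|S| + #|E| <= k /\ forall a b, s a b -> [\/ a \in S, b \in S | [set a; b] \in E].

Lemma weight_cover_setT s : weight_cover s (2 * #|V|).
Proof.
exists setT, set0; rewrite cardsT cards0 addn0; split=> // a b _.
by apply: Or31; rewrite inE.
Qed.

Lemma weight_cover_bigcup (J : finType) (s : J -> rel V) (k : J -> nat) :
  (forall j, weight_cover (s j) (k j)) ->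
  weight_cover (fun a b => [exists j, s j a b]) (\sum_j k j).
Proof.
move=> /fin_all_exists[S] /fin_all_exists[E] SE.
exists (\bigcup_j S j), (\bigcup_j E j); split=> [|a b /existsP[j sab]].
  apply: (@leq_trans (\sum_j (2 * #|S j| + #|E j|))).
    by rewrite big_split -big_distrr /= leq_add ?leq_mul ?leq_card_bigcup.
  by apply: leq_sum => j _; case: (SE j).
have [_ /(_ _ _ sab)[aS|bS|abE]] := SE j.
- by apply: Or31; apply/bigcupP; exists j.
- by apply: Or32; apply/bigcupP; exists j.
- by apply: Or33; apply/bigcupP; exists j.
Qed.

Lemma weight_cover_clique s k (A : {set V}) :
  {in A &, forall a b, a != b -> s a b} -> weight_cover s k -> 2 * #|A| <= k + 3.
Proof.
move=> clique [S [E [SEk cover]]]; pose T := A :\: S.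
have bin_leq : 'C(#|T|, 2) <= #|E|.
  rewrite -cards_draws; apply: subset_leq_card; apply/subsetP => B.
  rewrite inE => /andP[/subsetP BT /cards2P[a [b [ab eB]]]].
  have /setDP[aA aS] : a \in T by apply: BT; rewrite eB !inE eqxx.
  have /setDP[bA bS] : b \in T by apply: BT; rewrite eB !inE eqxx orbT.
  have [aS'|bS'|] := cover a b (clique a b aA bA ab); last by rewrite eB.
    by rewrite aS' in aS.
  by rewrite bS' in bS.
have := double_leq_bin2 #|T|; have := subset_leq_card (subsetIr A S).
by have := cardsID S A; rewrite -/T; lia.
Qed.

Definition centered om k := [exists c, \sum_(x | x != c) om x <= k].

(* The last two conditions matter only for five vertices and two coordinates: one
   coordinate must then have weight 5 where the other one has weight 0. *)
Definition exceptional om :=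
  [/\ \sum_x om x <= 13, exists u, om u = 0 & centered om 7 \/ forall x, om x <= 4].

Definition sparse_weights om := centered om 6 \/ exceptional om.

Definition sparse (s : V -> rel V) :=
  exists2 om : V -> nat, forall x, weight_cover (s x) (om x) & sparse_weights om.

(* A star [(x, a)] covers the cherries xa, xb for all b, and a triple [(x, a, b)]
   only the cherry xa, xb. *)
Definition covered (ss : seq (V * V)) (ts : seq (V * V * V)) x a b :=
  [|| (x, a) \in ss, (x, b) \in ss, (x, a, b) \in ts | (x, b, a) \in ts].

Definition weight_at (ss : seq (V * V)) (ts : seq (V * V * V)) x :=
  2 * count (fun i => i.1 == x) ss + count (fun i => i.1.1 == x) ts.

Lemma coveredC ss ts x a b : covered ss ts x a b = covered ss ts x b a.
Proof. by rewrite /covered orbCA [(_ \in ts) || _]orbC. Qed.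

Lemma weight_at_cover s ss ts x :
  (forall a b, s a b -> covered ss ts x a b) -> weight_cover s (weight_at ss ts x).
Proof.
move=> cov; pose S := [seq i.2 | i <- ss & i.1 == x].
pose E := [seq [set i.1.2; i.2] | i <- ts & i.1.1 == x].
exists [set a in S], [set A in E]; split.
  rewrite /weight_at -!size_filter -(size_map snd) -/S.
  rewrite -(size_map (fun i => [set i.1.2; i.2])).
  by rewrite leq_add ?leq_mul ?cardsE ?card_size.
move=> a b /cov /or4P[] mem; [apply: Or31 | apply: Or32 | apply: Or33 | apply: Or33];
  rewrite inE; apply/mapP.
- by exists (x, a); rewrite ?mem_filter ?eqxx.
- by exists (x, b); rewrite ?mem_filter ?eqxx.
- by exists (x, a, b); rewrite ?mem_filter ?eqxx.
- by exists (x, b, a); rewrite ?mem_filter ?eqxx //= setUC.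
Qed.

Lemma sum_weight_at (Q : pred V) ss ts :
  \sum_(x | Q x) weight_at ss ts x =
  2 * count (fun i => Q i.1) ss + count (fun i => Q i.1.1) ts.
Proof. by rewrite big_split -big_distrr /= !sum_count_fibers. Qed.

Lemma sum_weight_at_leq (Q : pred V) ss ts :
  \sum_(x | Q x) weight_at ss ts x <= 2 * size ss + size ts.
Proof. by rewrite sum_weight_at leq_add ?leq_mul ?count_size. Qed.

Lemma weight_at_eq0 ss ts x :
  x \notin map fst ss -> x \notin map (fun i => i.1.1) ts -> weight_at ss ts x = 0.
Proof.
move=> /count_memPn; rewrite count_map => xs /count_memPn; rewrite count_map => xt.
by rewrite /weight_at xs xt.
Qed.

Lemma exceptional_weight_at ss ts (Z : seq V) :
  size Z < #|V| -> 2 * size ss + size ts <= 13 ->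
  all (fun i => i.1 \in Z) ss -> all (fun i => i.1.1 \in Z) ts ->
  centered (weight_at ss ts) 7 \/ (forall x, weight_at ss ts x <= 4) ->
  exceptional (weight_at ss ts).
Proof.
move=> /exists_notin[u uZ] sz /allP ssZ /allP tsZ small_om; split=> //.
  exact: leq_trans (sum_weight_at_leq _ _ _) sz.
exists u; apply: weight_at_eq0; apply: contra uZ => /mapP[i i_in ->].
  exact: ssZ.
exact: tsZ.
Qed.

Lemma sparse_centered (s : V -> rel V) c ss ts :
  2 * size ss + size ts <= 6 ->
  (forall x a b, x <> c -> s x a b -> covered ss ts x a b) -> sparse s.
Proof.
move=> sz cov; exists (fun x => if x == c then 2 * #|V| else weight_at ss ts x).
  move=> x; case: eqP => [_|xc]; first exact: weight_cover_setT.
  by apply: weight_at_cover => a b; apply: cov.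
left; apply/existsP; exists c.
rewrite (eq_bigr (weight_at ss ts)) => [|x /negPf -> //].
exact: leq_trans (sum_weight_at_leq _ _ _) sz.
Qed.

Lemma sparse_exceptional (s : V -> rel V) ss ts :
  (forall x a b, s x a b -> covered ss ts x a b) -> exceptional (weight_at ss ts) ->
  sparse s.
Proof.
move=> cov exc; exists (weight_at ss ts); last by right.
by move=> x; apply: weight_at_cover => a b; apply: cov.
Qed.

End WeightCovers.

Section WeightCounting.

Variables V J : finType.
Implicit Types om : J -> V -> nat.

Lemma sum_bounds_geq om (N : {set J}) (k : J -> nat) m :
  (forall x, m <= \sum_j om j x) ->
  {in N, forall j, centered (om j) (k j)} ->
  {in ~: N, forall j, \sum_x om j x <= k j} ->
  (#|V| - #|N|) * m <= \sum_j k j.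
Proof.
move=> weight_geq centN totalN.
have [->|V_gt0] := posnP #|V|; first by [].
have [v0 _] : exists v0 : V, v0 \in V by apply/card_gt0P.
have [c cP] : exists c : J -> V, forall j, j \in N -> \sum_(x | x != c j) om j x <= k j.
  apply: (@fin_all_exists _ (fun=> V)
    (fun j c => j \in N -> \sum_(x | x != c) om j x <= k j)) => j.
  case: (boolP (j \in N)) => [/centN/existsP[c] sum_leq|_]; last by exists v0.
  by exists c.
pose X := ~: (c @: N).
have card_X : #|V| - #|N| <= #|X|.
  by rewrite leq_subLR -(cardsC (c @: N)) leq_add2r; apply: leq_imset_card.
apply: (@leq_trans (\sum_(x in X) \sum_j om j x)).
  apply: leq_trans (leq_mul card_X (leqnn m)) _.
  by rewrite -sum_nat_const; apply: leq_sum.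
rewrite exchange_big; apply: leq_sum => j _; have [jN|jN] := boolP (j \in N).
  apply: leq_trans (cP j jN); apply: leq_sum_sub => x.
  by apply: contraTneq => ->; rewrite inE negbK imset_f.
apply: leq_trans (totalN j _); last by rewrite inE.
exact: leq_sum_sub.
Qed.

Lemma exceptional_pair_centered om j : #|J| = 2 ->
  (forall x, 5 <= \sum_i om i x) -> (forall i, exceptional (om i)) -> centered (om j) 7.
Proof.
move=> card_J weight_geq exc; have [_ _ [//|om_leq4]] := exc j.
have /cards1P[i iP] : #|[set~ j]| == 1 by rewrite cardsC1 card_J.
have [_ [u om_u0] _] := exc i.
have := weight_geq u; rewrite (bigD1 j) //= (eq_bigl (mem [set i])) => [|i'].
  by rewrite big_set1 om_u0 addn0 leqNgt ltnS om_leq4.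
by rewrite -iP !inE.
Qed.

Lemma sparse_weights_card_leq om : 4 < #|V| ->
  (forall x, 2 * #|V| <= \sum_j om j x + 5) ->
  (forall j, sparse_weights (om j)) -> #|V| <= #|J| + 2.
Proof.
move=> V_gt4 weight_geq sparse_om; rewrite leqNgt; apply/negP => V_gt.
pose N := [set j | centered (om j) 6].
have exc j : j \notin N -> exceptional (om j).
  by rewrite inE; case: (sparse_om j) => // ->.
have : (#|V| - #|N|) * (2 * #|V| - 5) <= \sum_j (if j \in N then 6 else 13).
  apply: (sum_bounds_geq (om := om)) => [x|j jN|j].
  - by rewrite leq_subLR addnC.
  - by rewrite jN; move: jN; rewrite inE.
  - by rewrite inE => jN; rewrite (negPf jN); case: (exc j jN).
rewrite big_if /= !sum_nat_const => bound.
have card_N : #|N| + #|fun j => j \notin N| = #|J| := cardC (mem N).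
have [card_V card_J card_N0] : [/\ #|V| = 5, #|J| = 2 & #|N| = 0].
  move: bound card_N V_gt4 V_gt.
  move: #|V| #|J| #|N| => v d k; move: #|_| => m bound card_N v_gt4 d_lt.
  have [e v_eq] : exists e, v = k + 3 + e by exists (v - k - 3); lia.
  have v_eq5 : v = 5 by rewrite v_eq in bound v_gt4 d_lt *; nia.
  by rewrite v_eq5 in bound; split; lia.
have weight5 x : 5 <= \sum_j om j x.
  by rewrite -(leq_add2r 5); have := weight_geq x; rewrite card_V.
have {}exc j : exceptional (om j) by apply: exc; rewrite (cards0_eq card_N0) inE.
have : (#|V| - #|[set: J]|) * 5 <= \sum_(j : J) 7.
  apply: (sum_bounds_geq (om := om)) => // j; last by rewrite !inE.
  by move=> _; apply: exceptional_pair_centered.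
by rewrite sum_nat_const cardsT card_V card_J.
Qed.

End WeightCounting.

(** * Interval orders on edges *)

Section IntervalOrders.

Variable T : finType.
Implicit Types prec : rel T.

Definition two_plus_two_free prec := forall e f e' f',
  prec e f -> prec e' f' -> prec e f' || prec e' f.

Definition converse prec : rel T := fun e f => prec f e.

Lemma converse_two_plus_two_free prec :
  two_plus_two_free prec -> two_plus_two_free (converse prec).
Proof. by move=> free e f e' f' fe fe'; rewrite orbC; apply: free. Qed.

Lemma two_plus_two_free_first prec (e0 : T) : two_plus_two_free prec ->
  exists e, forall f g, prec f g -> prec e g.
Proof.
move=> free; have [e _ e_max] := arg_maxnP (fun e : T => #|prec e|) (erefl (xpredT e0)).
exists e => f g fg; apply/negPn/negP => neg.
have /subsetPn[h eh nfh] : ~~ (prec e \subset prec f).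
  apply/negP => sub; have : #|prec e| < #|prec f|.
    by apply: proper_card; apply/properP; split=> //; exists g.
  by rewrite ltnNge => /negP; apply; apply: e_max.
by have := free _ _ _ _ fg eh; rewrite (negPf neg) orbF; apply/negP.
Qed.

End IntervalOrders.

Section EdgeOrders.

Variable V : finType.
Implicit Types (prec : rel (V * V)) (x a b c p q u v w y : V) (e f g : V * V).

(* An edge ab of the complete graph on [V] is either of the pairs (a, b), (b, a). *)
Record edge_order prec : Prop := EdgeOrder {
  edge_order_neq a b x y : prec (a, b) (x, y) -> a <> b /\ x <> y;
  edge_order_swapl a b f : prec (a, b) f = prec (b, a) f;
  edge_order_swapr e x y : prec e (x, y) = prec e (y, x);
  edge_order_irr : irreflexive prec;
  edge_order_free : two_plus_two_free prec;
  edge_order_meet a b x y : prec (a, b) (x, y) -> [\/ a = x, a = y, b = x | b = y] }.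

Lemma converse_edge_order prec : edge_order prec -> edge_order (converse prec).
Proof.
case=> neq swapl swapr irr free meet; split; rewrite /converse.
- by move=> a b x y /neq[].
- by move=> a b f; rewrite swapr.
- by move=> e x y; rewrite swapl.
- exact: irr.
- exact: converse_two_plus_two_free.
- by move=> a b x y /meet[] ->; [apply: Or41|apply: Or43|apply: Or42|apply: Or44].
Qed.

Definition before prec x a b := prec (x, a) (x, b).

Definition separated prec x : rel V :=
  fun a b => before prec x a b || before prec x b a.

Lemma separated_covered prec ss ts x :
  (forall a b, before prec x a b -> covered ss ts x a b) ->
  forall a b, separated prec x a b -> covered ss ts x a b.
Proof. by move=> cov a b /orP[/cov|/cov] //; rewrite coveredC. Qed.

Lemma sparse_converse prec :
  sparse (separated (converse prec)) -> sparse (separated prec).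
Proof.
case=> om cover small; exists om => // x; have [S [E [SE cov]]] := cover x.
by exists S, E; split=> // a b; rewrite /separated orbC => /cov.
Qed.

(* The first edge is cp and the last edge is cq. *)
Record framed prec c p q : Prop := Framed {
  frame_order : edge_order prec;
  frame_first e f : prec e f -> prec (c, p) f;
  frame_last e f : prec e f -> prec e (c, q);
  frame_before : before prec c p q }.

Lemma framed_converse prec c p q : framed prec c p q -> framed (converse prec) c q p.
Proof.
case=> order first last cpq; split=> //; first exact: converse_edge_order.
- by move=> e f /last.
- by move=> e f /first.
Qed.

Lemma edge_order_framed prec e f : edge_order prec -> prec e f ->
  exists c p q, framed prec c p q.
Proof.
move=> order ef; have free := edge_order_free order.
have [[a b] first] := two_plus_two_free_first e free.
have [[x y] last] := two_plus_two_free_first e (converse_two_plus_two_free free).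
have abxy : prec (a, b) (x, y) by exact: last (first _ _ ef).
have first' g h : prec g h -> prec (b, a) h.
  by rewrite (edge_order_swapl order); exact: first.
have last' g h : prec g h -> prec g (y, x).
  by rewrite (edge_order_swapr order); exact: last.
case: (edge_order_meet order abxy) => E; subst.
- by exists x, b, y; split=> // g h; exact: last.
- by exists y, b, x; split=> //; exact: last' abxy.
- by exists x, a, y; split=> //; [move=> g h; exact: last | exact: first' abxy].
- by exists y, a, x; split=> //; exact: last' (first' _ _ abxy).
Qed.

End EdgeOrders.

Ltac by_meet order H := by case: (edge_order_meet order H); congruence.

Section Frames.

Variables (V : finType) (prec : rel (V * V)) (c p q : V).
Hypothesis frame : framed prec c p q.
Implicit Types (x a b u v w : V).

Let order : edge_order prec := frame_order frame.

Lemma before_neq x a b : before prec x a b -> [/\ x <> a, x <> b & a <> b].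
Proof.
move=> xab; have [xa xb] := edge_order_neq order xab; split=> // ab.
by move: xab; rewrite /before ab (edge_order_irr order).
Qed.

Lemma before_asym x a b : before prec x a b -> ~ before prec x b a.
Proof.
move=> xab xba.
by case/orP: (edge_order_free order xab xba); rewrite (edge_order_irr order).
Qed.

Lemma frame_neq : [/\ c <> p, c <> q & p <> q].
Proof. exact: before_neq (frame_before frame). Qed.

Lemma frame_uniq : uniq [:: c; p; q].
Proof.
by have [/eqP cp /eqP cq /eqP pq] := frame_neq; rewrite /= !inE negb_or cp cq pq.
Qed.

Lemma frame_count_leq1 w x :
  w \notin [:: c; p; q] -> count_mem x [:: w; c; p; q] <= 1.
Proof.
by move=> w_out; rewrite count_uniq_mem ?leq_b1 // cons_uniq w_out frame_uniq.
Qed.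

(* Compare xb with the first edge cp and xa with the last edge cq. *)
Lemma before_off_center x a b : x <> c -> before prec x a b ->
  (x = p \/ b = c \/ b = p) /\ (x = q \/ a = c \/ a = q).
Proof.
move=> xc xab; have first := frame_first frame xab; have last := frame_last frame xab.
by split; [case: (edge_order_meet order first) | case: (edge_order_meet order last)];
  auto; congruence.
Qed.

Lemma before_center_neq a b : before prec c a b -> a <> q /\ b <> p.
Proof.
move=> cab; split=> E; rewrite E in cab.
  by have := frame_last frame cab; rewrite (edge_order_irr order).
by have := frame_first frame cab; rewrite (edge_order_irr order).
Qed.

Lemma before_pq_neq u : before prec p q u -> u <> c.
Proof.
move=> pqu uc; subst u; have := frame_first frame pqu.
by rewrite (edge_order_swapl order) (edge_order_irr order).
Qed.

Lemma before_p_neq w a : w <> c -> w <> q -> before prec w a p ->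
  w <> p /\ (a = c \/ a = q).
Proof.
move=> wc wq wap; have [_ [//|a_cq]] := before_off_center wc wap.
by have [_ wp _] := before_neq wap.
Qed.

Lemma before_p_center_uniq w w' a a' : w <> c -> w <> q -> w' <> c -> w' <> q ->
  before prec w a p -> before prec w' a' p -> w = w'.
Proof.
move=> wc wq w'c w'q wap w'a'p; have [cp cq pq] := frame_neq.
have [wp a_cq] := before_p_neq wc wq wap.
have [w'p a'_cq] := before_p_neq w'c w'q w'a'p.
have [//|/eqP ww'] := eqVneq w w'.
case/orP: (edge_order_free order wap w'a'p) => cross; exfalso.
  by case: a_cq => ?; subst a; by_meet order cross.
by case: a'_cq => ?; subst a'; by_meet order cross.
Qed.

Lemma before_qp_neq w : before prec w q p -> [/\ w <> c, w <> p & w <> q].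
Proof.
move=> wqp; have [wq wp _] := before_neq wqp; split=> // wc.
by rewrite wc in wqp; case: (before_asym (frame_before frame)).
Qed.

Lemma before_p_qp_uniq w x a : before prec w q p -> x <> c -> x <> q ->
  before prec x a p -> x = w.
Proof.
move=> wqp xc xq xap; have [wc _ wq] := before_qp_neq wqp.
exact: before_p_center_uniq xap wqp.
Qed.

Lemma exists_before_p_center : 3 < #|V| ->
  exists2 w, w \notin [:: c; p; q] &
    forall x a, x <> c -> x <> q -> before prec x a p -> x = w.
Proof.
move=> V_gt3; pose late w := [&& w != c, w != q & [exists a, before prec w a p]].
have [/existsP[w /and3P[/eqP wc /eqP wq /existsP[a wap]]]|none] :=
  boolP [exists w, late w].
  exists w => [|x b xc xq xbp]; last exact: before_p_center_uniq xbp wap.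
  have [/eqP wp _] := before_p_neq wc wq wap; move/eqP: wc => wc; move/eqP: wq => wq.
  by rewrite !inE !negb_or wc wp wq.
have [w w_out] := exists_notin (s := [:: c; p; q]) V_gt3.
exists w => // x a /eqP xc /eqP xq xap; case/existsP: none; exists x.
by rewrite /late xc xq; apply/existsP; exists a.
Qed.

Lemma before_pq_qp w u : before prec p q u -> before prec w q p -> before prec p q w.
Proof.
move=> pqu wqp; have [cp cq pq] := frame_neq; have uc := before_pq_neq pqu.
have [_ pu _] := before_neq pqu; have [_ _ qu] := before_neq pqu.
have [wc wp wq] := before_qp_neq wqp; have [<-//|/eqP uw] := eqVneq u w.
case/orP: (edge_order_free order wqp pqu) => cross; first by_meet order cross.
by rewrite /before (edge_order_swapr order).
Qed.

Lemma before_pq_qc w u : before prec p q u -> before prec w q c ->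
  u = w /\ before prec w q p.
Proof.
move=> pqu wqc; have [cp cq pq] := frame_neq; have uc := before_pq_neq pqu.
have [wq wc _] := before_neq wqc; have [_ pu qu] := before_neq pqu.
have wp : w <> p.
  move=> wp; subst w; have := frame_first frame wqc.
  by rewrite (edge_order_swapl order) (edge_order_irr order).
case/orP: (edge_order_free order wqc pqu) => cross; last by_meet order cross.
have uw : u = w by by_meet order cross.
by split=> //; rewrite -{1}uw /before (edge_order_swapr order) uw in cross *.
Qed.

Lemma before_pq_up u v : before prec p q u -> before prec q v p ->
  u = v /\ before prec u q p.
Proof.
move=> pqu qvp; have [cp cq pq] := frame_neq; have uc := before_pq_neq pqu.
have [_ pu qu] := before_neq pqu; have [qv _ vp] := before_neq qvp.
case/orP: (edge_order_free order pqu qvp) => cross.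
  by move: cross; rewrite (edge_order_swapl order) (edge_order_irr order).
have uv : u = v by by_meet order cross.
split=> //; move: cross.
by rewrite -uv /before (edge_order_swapl order) (edge_order_swapr order).
Qed.

Lemma before_pq_center u a b : before prec p q u -> before prec c a b ->
  a <> p -> b <> q -> a = u.
Proof.
move=> pqu cab ap bq; have [aq bp] := before_center_neq cab.
have [cp cq pq] := frame_neq; have uc := before_pq_neq pqu.
by case/orP: (edge_order_free order cab pqu) => cross; by_meet order cross.
Qed.

Lemma before_qp_center w a b : before prec w q p -> before prec c a b ->
  a <> p -> b <> q -> a = w \/ b = w.
Proof.
move=> wqp cab ap bq; have [aq bp] := before_center_neq cab.
have [cp cq pq] := frame_neq; have [wc _ _] := before_qp_neq wqp.
by case/orP: (edge_order_free order cab wqp) => cross;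
  case: (edge_order_meet order cross); auto; congruence.
Qed.

Section Covers.

Variables (ss : seq (V * V)) (ts : seq (V * V * V)).
Hypotheses (pc_ss : (p, c) \in ss) (qc_ss : (q, c) \in ss).
Hypothesis cov_pq : forall u, before prec p q u -> covered ss ts p q u.
Hypothesis cov_up : forall u, before prec q u p -> covered ss ts q u p.
Hypothesis cov_cp : forall x,
  x <> c -> x <> q -> before prec x c p -> covered ss ts x c p.
Hypothesis cov_qc : forall x,
  x <> c -> x <> p -> before prec x q c -> covered ss ts x q c.
Hypothesis cov_qp : forall x, before prec x q p -> covered ss ts x q p.

Lemma off_center_covered x a b : x <> c -> before prec x a b -> covered ss ts x a b.
Proof.
move=> xc xab.
have [xa xb ab] := before_neq xab; have [cp cq pq] := frame_neq.
have pc y : covered ss ts p c y by rewrite /covered pc_ss.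
have qc y : covered ss ts q y c by rewrite /covered qc_ss orbT.
have [[xp|[bc|bp]] [xq|[ac|aq]]] := before_off_center xc xab; try congruence.
- by rewrite xp aq in xab *; apply: cov_pq.
- have [xp|/eqP xp] := eqVneq x p; first by rewrite xp bc coveredC.
  by rewrite aq bc in xab *; apply: cov_qc.
- by rewrite xq bp in xab *; apply: cov_up.
- have [xq|/eqP xq] := eqVneq x q; first by rewrite xq ac coveredC.
  by rewrite ac bp in xab *; apply: cov_cp.
- by rewrite aq bp in xab *; apply: cov_qp.
Qed.

Lemma frame_covered : (c, p) \in ss -> (c, q) \in ss ->
  (forall a b, a <> p -> b <> q -> before prec c a b -> covered ss ts c a b) ->
  forall x a b, before prec x a b -> covered ss ts x a b.
Proof.
move=> cp_ss cq_ss cov_inner x a b xab.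
have [xc|/eqP xc] := eqVneq x c; last exact: off_center_covered xab.
rewrite xc in xab *.
have [ap|/eqP ap] := eqVneq a p; first by rewrite ap /covered cp_ss.
have [bq|/eqP bq] := eqVneq b q; first by rewrite bq /covered cq_ss orbT.
exact: cov_inner.
Qed.

End Covers.

End Frames.

Section Sparsity.

Variable V : finType.
Implicit Types (prec : rel (V * V)) (c p q u v w x y : V).

Ltac listed := by rewrite /covered !inE !eqxx ?orbT.

Lemma sparse_separated_centered prec c ss ts :
  2 * size ss + size ts <= 6 ->
  (forall x a b, x <> c -> before prec x a b -> covered ss ts x a b) ->
  sparse (separated prec).
Proof.
move=> sz cov; apply: (sparse_centered (c := c) sz) => x a b xc.
by apply: separated_covered => {}a {}b; apply: cov.
Qed.

Lemma sparse_separated_exceptional prec ss ts (Z : seq V) :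
  size Z < #|V| -> 2 * size ss + size ts <= 13 ->
  all (fun i => i.1 \in Z) ss -> all (fun i => i.1.1 \in Z) ts ->
  centered (weight_at ss ts) 7 \/ (forall x, weight_at ss ts x <= 4) ->
  (forall x a b, before prec x a b -> covered ss ts x a b) ->
  sparse (separated prec).
Proof.
move=> Zlt sz ssZ tsZ small_om cov; apply: (sparse_exceptional (ss := ss) (ts := ts)).
  by move=> x a b; apply: separated_covered; apply: cov.
exact: exceptional_weight_at ssZ tsZ small_om.
Qed.

Hypothesis V_gt4 : 4 < #|V|.

Lemma sparse_two_pq prec c p q u u' : framed prec c p q ->
  before prec p q u -> before prec p q u' -> u <> u' -> sparse (separated prec).
Proof.
move=> frame pqu pqu' uu'.
have [w w_out w_uniq] := exists_before_p_center frame (ltnW V_gt4).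
apply: (sparse_separated_exceptional
  (ss := [:: (c, p); (c, q); (p, c); (q, c); (p, q)]) (ts := [:: (w, c, p); (w, q, p)])
  (Z := [:: w; c; p; q])) => //; try by rewrite /= !inE !eqxx ?orbT.
  right=> x; have := frame_count_leq1 frame x w_out.
  by rewrite /weight_at /=; move: (c == x) (p == x) (q == x) (w == x); lia.
apply: (frame_covered frame); rewrite ?inE ?eqxx ?orbT //.
- by move=> v _; listed.
- move=> v qvp; case: uu'.
  have [-> _] := before_pq_up frame pqu qvp.
  by have [-> _] := before_pq_up frame pqu' qvp.
- by move=> x xc xq xcp; rewrite (w_uniq _ _ xc xq xcp); listed.
- move=> x xc xp xqc; case: uu'.
  have [-> _] := before_pq_qc frame pqu xqc.
  by have [-> _] := before_pq_qc frame pqu' xqc.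
- move=> x xqp; have [xc _ xq] := before_qp_neq frame xqp.
  by rewrite (w_uniq _ _ xc xq xqp); listed.
- move=> a b ap bq cab; case: uu'.
  rewrite -(before_pq_center frame pqu cab ap bq).
  exact: (before_pq_center frame pqu' cab ap bq).
Qed.

Lemma sparse_pq prec c p q u : framed prec c p q ->
  (forall w, ~ before prec w q p) -> before prec p q u -> sparse (separated prec).
Proof.
move=> frame no_reversal pqu.
have [/existsP[v /andP[vu pqv]]|uniq_u] :=
  boolP [exists v, (v != u) && before prec p q v].
  by apply: (sparse_two_pq frame pqv pqu); apply/eqP.
have [w _ w_uniq] := exists_before_p_center frame (ltnW V_gt4).
apply: (sparse_separated_centered (c := c)
  (ss := [:: (p, c); (q, c)]) (ts := [:: (w, c, p); (p, q, u)])) => //.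
apply: (off_center_covered frame); rewrite ?inE ?eqxx ?orbT //.
- move=> v pqv; have [->|vu] := eqVneq v u; first by listed.
  by case/existsP: uniq_u; exists v; rewrite vu.
- by move=> v qvp; have [_ /no_reversal] := before_pq_up frame pqu qvp.
- by move=> x xc xq xcp; rewrite (w_uniq _ _ xc xq xcp); listed.
- by move=> x xc xp xqc; have [_ /no_reversal] := before_pq_qc frame pqu xqc.
- by move=> x /no_reversal.
Qed.

Lemma sparse_no_pq prec c p q : framed prec c p q ->
  (forall w, ~ before prec w q p) -> (forall u, ~ before prec p q u) ->
  (forall u, ~ before prec q u p) -> sparse (separated prec).
Proof.
move=> frame no_reversal no_pq no_qp.
have [w _ w_uniq] := exists_before_p_center frame (ltnW V_gt4).
have [w' _ w'_uniq] := exists_before_p_center (framed_converse frame) (ltnW V_gt4).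
apply: (sparse_separated_centered (c := c)
  (ss := [:: (p, c); (q, c)]) (ts := [:: (w, c, p); (w', q, c)])) => //.
apply: (off_center_covered frame); rewrite ?inE ?eqxx ?orbT //.
- by move=> u /no_pq.
- by move=> u /no_qp.
- by move=> x xc xq xcp; rewrite (w_uniq _ _ xc xq xcp); listed.
- by move=> x xc xp xqc; rewrite (w'_uniq _ _ xc xp xqc); listed.
- by move=> x /no_reversal.
Qed.

Lemma sparse_no_reversal prec c p q : framed prec c p q ->
  (forall w, ~ before prec w q p) -> sparse (separated prec).
Proof.
move=> frame no_reversal.
have [/existsP[u pqu]|/existsPn no_pq] := boolP [exists u, before prec p q u].
  exact: sparse_pq frame no_reversal pqu.
have [/existsP[u qup]|/existsPn no_qp] := boolP [exists u, before prec q u p].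
  by apply: sparse_converse; apply: sparse_pq (framed_converse frame) _ qup.
apply: (sparse_no_pq frame no_reversal) => u; first exact/negP/no_pq.
exact/negP/no_qp.
Qed.

Definition tight_reversal prec c p q w :=
  [/\ framed prec c p q, before prec w q p, forall u, before prec p q u -> u = w &
      forall u, before prec q u p -> u = w].

Lemma tight_reversal_converse prec c p q w :
  tight_reversal prec c p q w -> tight_reversal (converse prec) c q p w.
Proof. by case=> /framed_converse. Qed.

Lemma tight_reversal_qp prec c p q w x : tight_reversal prec c p q w ->
  before prec x q p -> x = w.
Proof.
case=> frame wqp _ _ xqp; have [xc _ xq] := before_qp_neq frame xqp.
exact: (before_p_qp_uniq frame wqp xc xq xqp).
Qed.

Lemma tight_reversal_cp prec c p q w x : tight_reversal prec c p q w ->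
  x <> c -> x <> q -> before prec x c p -> x = w.
Proof. by case=> frame wqp _ _; apply: before_p_qp_uniq. Qed.

Lemma tight_reversal_qc prec c p q w x : tight_reversal prec c p q w ->
  x <> c -> x <> p -> before prec x q c -> x = w.
Proof. by move=> /tight_reversal_converse; apply: tight_reversal_cp. Qed.

(* The cherry cw, cy excludes the cherries qw, qp and wq, wc. *)
Lemma sparse_tight_reversal_inner prec c p q w y : tight_reversal prec c p q w ->
  before prec c w y -> y <> q -> sparse (separated prec).
Proof.
move=> tight cwy yq; have [frame wqp pq_w up_w] := tight.
have order := frame_order frame; have [cp cq pq] := frame_neq frame.
have [wc wp wq] := before_qp_neq frame wqp; have [cw cy wy] := before_neq frame cwy.
apply: (sparse_separated_exceptional
  (ss := [:: (c, p); (c, q); (c, w); (p, c); (q, c)])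
  (ts := [:: (w, c, p); (w, q, p); (p, q, w)])
  (Z := [:: w; c; p; q])) => //; try by rewrite /= !inE !eqxx ?orbT.
  left; apply/existsP; exists c; rewrite sum_weight_at /= !eqxx /=.
  by move: (p != c) (q != c) (w != c); lia.
apply: (frame_covered frame); rewrite ?inE ?eqxx ?orbT //.
- by move=> u /pq_w ->; listed.
- move=> u qup; have uw := up_w u qup; rewrite uw in qup *.
  by case/orP: (edge_order_free order qup cwy) => cross; by_meet order cross.
- by move=> x xc xq /(tight_reversal_cp tight xc xq) ->; listed.
- move=> x xc xp xqc; have xw := tight_reversal_qc tight xc xp xqc.
  rewrite xw in xqc *; case/orP: (edge_order_free order xqc cwy) => cross.
    by_meet order cross.
  by move: cross; rewrite (edge_order_swapl order) (edge_order_irr order).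
- by move=> x /(tight_reversal_qp tight) ->; listed.
- move=> a b ap bq cab.
  by have [->|->] := before_qp_center frame wqp cab ap bq; listed.
Qed.

Lemma sparse_tight_reversal_flat prec c p q w : tight_reversal prec c p q w ->
  (forall a b, a <> p -> b <> q -> ~ before prec c a b) -> sparse (separated prec).
Proof.
move=> tight flat; have [frame wqp pq_w up_w] := tight.
have w_out : w \notin [:: c; p; q].
  have [/eqP wc /eqP wp /eqP wq] := before_qp_neq frame wqp.
  by rewrite !inE !negb_or wc wp wq.
apply: (sparse_separated_exceptional
  (ss := [:: (c, p); (c, q); (p, c); (q, c)])
  (ts := [:: (w, c, p); (w, q, c); (w, q, p); (p, q, w); (q, w, p)])
  (Z := [:: w; c; p; q])) => //; try by rewrite /= !inE !eqxx ?orbT.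
  right=> x; have := frame_count_leq1 frame x w_out.
  by rewrite /weight_at /=; move: (c == x) (p == x) (q == x) (w == x); lia.
apply: (frame_covered frame); rewrite ?inE ?eqxx ?orbT //.
- by move=> u /pq_w ->; listed.
- by move=> u /up_w ->; listed.
- by move=> x xc xq /(tight_reversal_cp tight xc xq) ->; listed.
- by move=> x xc xp /(tight_reversal_qc tight xc xp) ->; listed.
- by move=> x /(tight_reversal_qp tight) ->; listed.
- by move=> a b ap bq /(flat a b ap bq).
Qed.

Lemma sparse_tight_reversal prec c p q w :
  tight_reversal prec c p q w -> sparse (separated prec).
Proof.
move=> tight; have [frame wqp _ _] := tight.
have [/existsP[y /andP[/eqP yq cwy]]|no_cw] :=
  boolP [exists y, (y != q) && before prec c w y].
  exact: sparse_tight_reversal_inner tight cwy yq.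
have [/existsP[y /andP[/eqP yp cyw]]|no_wc] :=
  boolP [exists y, (y != p) && before prec c y w].
  apply: sparse_converse.
  exact: sparse_tight_reversal_inner (tight_reversal_converse tight) cyw yp.
apply: (sparse_tight_reversal_flat tight) => a b ap bq cab.
have [aw|bw] := before_qp_center frame wqp cab ap bq.
  by case/existsP: no_cw; exists b; rewrite -aw cab andbT; apply/eqP.
by case/existsP: no_wc; exists a; rewrite -bw cab andbT; apply/eqP.
Qed.

Lemma sparse_reversal prec c p q w : framed prec c p q ->
  before prec w q p -> sparse (separated prec).
Proof.
move=> frame wqp; have frame' := framed_converse frame.
have [/existsP[u /andP[/eqP uw pqu]]|pq_w] :=
  boolP [exists u, (u != w) && before prec p q u].
  exact: sparse_two_pq frame pqu (before_pq_qp frame pqu wqp) uw.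
have [/existsP[u /andP[/eqP uw qup]]|up_w] :=
  boolP [exists u, (u != w) && before prec q u p].
  apply: sparse_converse.
  exact: sparse_two_pq frame' qup (before_pq_qp frame' qup wqp) uw.
apply: (@sparse_tight_reversal _ c p q w); split=> // u; apply: contraPeq => uw.
  by move=> pqu; case/existsP: pq_w; exists u; rewrite uw.
by move=> qup; case/existsP: up_w; exists u; rewrite uw.
Qed.

Lemma edge_order_sparse prec : edge_order prec -> sparse (separated prec).
Proof.
move=> order; have [/existsP[[e f] ef]|none] := boolP [exists ef, prec ef.1 ef.2].
  have [c [p [q frame]]] := edge_order_framed order ef.
  have [/existsP[w wqp]|/existsPn no_reversal] := boolP [exists w, before prec w q p].
    exact: sparse_reversal frame wqp.
  by apply: (sparse_no_reversal frame) => w; exact/negP.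
have [c _] : exists c : V, c \in V by apply/card_gt0P; apply: leq_trans V_gt4.
apply: (sparse_separated_centered (c := c) (ss := [::]) (ts := [::])) => // x a b _ xab.
by case/existsP: none; exists ((x, a), (x, b)).
Qed.

Lemma separating_edge_orders_geq (J : finType) (prec : J -> rel (V * V)) :
  (forall j, edge_order (prec j)) ->
  (forall x a b, a <> x -> b <> x -> a <> b -> exists j, separated (prec j) x a b) ->
  #|V| <= #|J| + 2.
Proof.
move=> order separating.
have [om cover small] := fin_all_exists2 (fun j => edge_order_sparse (order j)).
apply: (sparse_weights_card_leq V_gt4) small => x.
have clique : {in [set~ x] &, forall a b, a != b ->
    [exists j, separated (prec j) x a b]}.
  move=> a b; rewrite !inE => /eqP ax /eqP bx /eqP ab.
  by have [j sep] := separating x a b ax bx ab; apply/existsP; exists j.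
have := weight_cover_clique clique (weight_cover_bigcup (cover^~ x)).
by rewrite cardsC1; case: #|V| V_gt4 => // v _; lia.
Qed.

End Sparsity.

(** * Box representations *)

Section IntervalRepresentations.

Local Open Scope ring_scope.

Variable R : realType.

Definition interval_representation (G : sgraph) (I : finType) (l r : I -> G -> R) :=
  (forall i v, l i v <= r i v) /\
  forall u v, u != v -> adj u v = [forall i, (l i u <= r i v) && (l i v <= r i u)].

Lemma box_meetP d (a b a' b' : 'rV[R]_d) :
  (forall j, a 0 j <= b 0 j) -> (forall j, a' 0 j <= b' 0 j) ->
  (exists x, box a b x /\ box a' b' x) <->
  forall j, (a 0 j <= b' 0 j) && (a' 0 j <= b 0 j).
Proof.
move=> ab ab'; split=> [[x [xab xab']] j|meet].
  have /andP[ax xb] := xab j; have /andP[a'x xb'] := xab' j.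
  by rewrite (le_trans ax xb') (le_trans a'x xb).
exists (\row_j Num.max (a 0 j) (a' 0 j)).
by split=> j; have /andP[ab'j a'bj] := meet j;
  rewrite !mxE le_max ge_max lexx ?ab ?ab' ?ab'j ?a'bj ?orbT.
Qed.

Lemma box_representableP (G : sgraph) (I : finType) :
  box_representable R G #|I| <->
  exists l r : I -> G -> R, interval_representation l r.
Proof.
split=> [[a [b [ab adjP]]]|[l [r [lr adjE]]]].
  exists (fun i v => a v 0 (enum_rank i)), (fun i v => b v 0 (enum_rank i)).
  split=> [i v|u v uv]; first exact: ab.
  apply/idP/forallP => [/adjP-/(_ uv)/box_meetP meet i|meet]; first exact: meet.
  apply/adjP => //; apply/box_meetP => // j.
  by have := meet (enum_val j); rewrite enum_valK.
exists (fun v => \row_j l (enum_val j) v), (fun v => \row_j r (enum_val j) v).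
split=> [v j|u v uv]; first by rewrite !mxE.
rewrite adjE //; split=> [/forallP meet|/box_meetP meet].
  by apply/box_meetP => j; rewrite !mxE.
apply/forallP => i; have := meet _ _ (enum_rank i); rewrite !mxE enum_rankK.
by apply=> j; rewrite !mxE.
Qed.

End IntervalRepresentations.

Lemma kneser_adjE n k (u v : kneser n k) : u != v -> adj u v = [disjoint val u & val v].
Proof. by rewrite /adj /= /kneser_adj => ->. Qed.

Section LowerBound.

Local Open Scope ring_scope.

Variables (R : realType) (n : nat) (I : finType) (l r : I -> kneser n 2 -> R).
Hypothesis lr_repr : interval_representation l r.
Implicit Types (e f : 'I_n * 'I_n).

Definition edge e : option (kneser n 2) := insub [set e.1; e.2].

Definition coordinate_order i : rel ('I_n * 'I_n) := fun e f =>
  if (edge e, edge f) is (Some u, Some v) then r i u < l i v else false.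

Lemma coordinate_orderP i e f : reflect
  (exists u v : kneser n 2, [/\ edge e = Some u, edge f = Some v & r i u < l i v])
  (coordinate_order i e f).
Proof.
rewrite /coordinate_order; apply: (iffP idP) => [|[u [v [-> ->]]] //].
by case: (edge e) (edge f) => [u|] [v|] // ruv; exists u, v.
Qed.

Lemma edgeC a b : edge (a, b) = edge (b, a).
Proof. by rewrite /edge /= setUC. Qed.

Lemma edge_SomeP a b (u : kneser n 2) :
  edge (a, b) = Some u -> val u = [set a; b] /\ a <> b.
Proof.
rewrite /edge; case: insubP => // u' _ u'E [<-]; split=> // ab.
by have := valP u'; rewrite u'E /= ab setUid cards1.
Qed.

Lemma edge_neq a b : a <> b ->
  exists2 u : kneser n 2, edge (a, b) = Some u & val u = [set a; b].
Proof.
move=> /eqP ab; have card_ab : #|[set a; b]| == 2%N by rewrite cards2 ab.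
by exists (Sub [set a; b] card_ab) => //; apply: insubT.
Qed.

Lemma coordinate_order_edge_order i : edge_order (coordinate_order i).
Proof.
have [lr adjE] := lr_repr; split.
- move=> a b x y /coordinate_orderP[u [v [/edge_SomeP[_ ab] /edge_SomeP[_ xy] _]]].
  by split.
- by move=> a b f; rewrite /coordinate_order edgeC.
- by move=> e x y; rewrite /coordinate_order (edgeC x).
- move=> e; apply/negP => /coordinate_orderP[u [v [-> [<-]]]].
  by rewrite ltNge lr.
- move=> e f e' f' /coordinate_orderP[u [v [eu fv ruv]]].
  move=> /coordinate_orderP[u' [v' [eu' fv' ruv']]].
  rewrite /coordinate_order eu fv eu' fv'; have [//|lru] := ltP (r i u) (l i v').
  exact: lt_trans ruv' (le_lt_trans lru ruv).
move=> a b x y /coordinate_orderP[u [v [/edge_SomeP[uE _] /edge_SomeP[vE _] ruv]]].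
have not_disjoint : ~~ [disjoint val u & val v].
  have [->|uv] := eqVneq u v.
    by rewrite -setI_eq0 setIid vE; apply/set0Pn; exists x; rewrite !inE eqxx.
  rewrite -kneser_adjE // adjE //; apply/forallPn; exists i.
  by rewrite negb_and -!ltNge ruv orbT.
move: not_disjoint; rewrite -setI_eq0 uE vE => /set0Pn[z].
by rewrite !inE => /andP[/orP[]/eqP-> /orP[]/eqP->];
  [apply: Or41|apply: Or42|apply: Or43|apply: Or44].
Qed.

Lemma coordinate_order_separating x a b : a <> x -> b <> x -> a <> b ->
  exists i, separated (coordinate_order i) x a b.
Proof.
move=> ax bx ab; have [_ adjE] := lr_repr.
have [u xau uE] := edge_neq (nesym ax); have [v xbv vE] := edge_neq (nesym bx).
have uv : u != v.
  apply/eqP => uv; have : a \in [set x; b] by rewrite -vE -uv uE !inE eqxx orbT.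
  by rewrite !inE => /orP[]/eqP.
have : ~~ adj u v.
  rewrite kneser_adjE // -setI_eq0 uE vE.
  by apply/set0Pn; exists x; rewrite !inE eqxx.
rewrite adjE // => /forallPn[i]; rewrite negb_and -!ltNge => disjoint_i.
by exists i; rewrite /separated /before /coordinate_order xau xbv orbC.
Qed.

End LowerBound.

Lemma kneser2_box_representable_geq (R : realType) n d :
  4 < n -> box_representable R (kneser n 2) d -> n <= d + 2.
Proof.
move=> n_gt4; rewrite -[d in box_representable _ _ d]card_ord.
move=> /box_representableP[l [r lr]].
rewrite -[n in n <= _]card_ord -[d]card_ord.
apply: (separating_edge_orders_geq _ (prec := coordinate_order l r)).
- by rewrite card_ord.
- exact: coordinate_order_edge_order.
- exact: coordinate_order_separating.
Qed.

Section UpperBound.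

Variable n : nat.
Implicit Types (v w y : 'I_n.+1) (A B : {set 'I_n.+1}).

(* The edge A is an interval in the coordinate of v; if v is in A, then the sum is
   just the other vertex of A. *)
Definition left_end v A : nat :=
  if v \in A then \sum_(i in A :\ v) i else ord0 \in A.

Definition right_end v A : nat :=
  if v \in A then \sum_(i in A :\ v) i else n - (ord_max \in A).

Lemma sum_pair_setD1 v y : v != y -> \sum_(i in [set v; y] :\ v) i = y.
Proof. by move=> vy; rewrite setU1K ?inE // big_set1. Qed.

Lemma pair_other v A : #|A| = 2 -> v \in A -> exists2 y, v != y & A = [set v; y].
Proof.
move=> card_A vA; have /cards1P[y yP] : #|A :\ v| == 1.
  by have := cardsD1 v A; rewrite vA card_A => /eqP; rewrite eq_sym.
exists y; last by rewrite -(setD1K vA) yP.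
by have /setD1P[yv _] : y \in A :\ v by [rewrite yP inE]; rewrite eq_sym.
Qed.

Lemma left_leq_right v A : 1 < n -> left_end v A <= right_end v A.
Proof.
move=> n_gt1; rewrite /left_end /right_end; case: ifP => // _.
by do 2!case: (_ \in _); lia.
Qed.

Lemma disjoint_left_leq_right v A B : 1 < n -> #|A| = 2 -> #|B| = 2 ->
  [disjoint A & B] -> left_end v A <= right_end v B.
Proof.
move=> n_gt1 card_A card_B disj; rewrite /left_end /right_end.
have [vA|vA] := boolP (v \in A).
  have [y vy AE] := pair_other card_A vA.
  have yA : y \in A by rewrite AE !inE eqxx orbT.
  rewrite (disjointFr disj vA) {1}AE sum_pair_setD1 //.
  have [maxB|_] := boolP (ord_max \in B); last by rewrite subn0 -ltnS.
  have y_neq : y != ord_max by apply: contraFneq (disjointFr disj yA) => ->.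
  by have := ltn_ord y; move: y_neq; rewrite -val_eqE /=; lia.
have [vB|vB] := boolP (v \in B); last by do 2!case: (_ \in _); lia.
have [y vy BE] := pair_other card_B vB.
have yB : y \in B by rewrite BE !inE eqxx orbT.
rewrite {1}BE sum_pair_setD1 //.
have [A0|] // := boolP (ord0 \in A).
have y_neq : y != ord0 by apply: contraFneq (disjointFl disj yB) => ->.
by rewrite lt0n.
Qed.

Lemma ends_pair v y : v != y ->
  left_end v [set v; y] = y /\ right_end v [set v; y] = y.
Proof. by move=> vy; rewrite /left_end /right_end !inE eqxx sum_pair_setD1. Qed.

Lemma extreme_ends_disjoint v w B :
  0 < n -> w \in [set ord0; ord_max] -> v != w -> w \in B -> v \notin B ->
  (right_end v [set v; w] < left_end v B) || (right_end v B < left_end v [set v; w]).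
Proof.
move=> n_gt0 w_extreme vw wB vB; have [-> ->] := ends_pair vw.
rewrite /left_end /right_end (negPf vB).
move: w_extreme wB; rewrite !inE => /orP[]/eqP-> ->; first by [].
by rewrite /= subn1 prednK ?leqnn ?orbT.
Qed.

Lemma meeting_ends_disjoint A B : 0 < n -> #|A| = 2 -> #|B| = 2 -> A != B ->
  ~~ [disjoint A & B] -> exists2 v, v \notin [set ord0; ord_max] &
    (right_end v A < left_end v B) || (right_end v B < left_end v A).
Proof.
move=> n_gt0 card_A card_B AB; rewrite -setI_eq0 => /set0Pn[w /setIP[wA wB]].
have [y wy AE] := pair_other card_A wA; have [t wt BE] := pair_other card_B wB.
have yt : y != t by apply: contraNneq AB => yt; rewrite AE BE yt.
have [w_extreme|w_inner] := boolP (w \in [set ord0; ord_max]); last first.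
  exists w => //; rewrite AE BE.
  by have [-> ->] := ends_pair wy; have [-> ->] := ends_pair wt; rewrite -neq_ltn.
have [y_extreme|y_inner] := boolP (y \in [set ord0; ord_max]); last first.
  exists y => //; rewrite AE setUC; apply: extreme_ends_disjoint => //.
    by rewrite eq_sym.
  by rewrite BE !inE negb_or eq_sym wy.
exists t; last first.
  rewrite orbC BE setUC; apply: extreme_ends_disjoint => //; first by rewrite eq_sym.
  by rewrite AE !inE negb_or !(eq_sym t) wt.
move: w_extreme y_extreme wy wt yt; rewrite !inE => /orP[]/eqP-> /orP[]/eqP->;
  by rewrite ?eqxx // !(eq_sym _ t) negb_or => _ -> ->.
Qed.

End UpperBound.

Lemma kneser2_box_representable (R : realType) n :
  2 < n -> box_representable R (kneser n 2) (n - 2).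
Proof.
case: n => // n n_gt2.
pose inner : finType := {v : 'I_n.+1 | v \notin [set ord0; ord_max]}.
have -> : n.+1 - 2 = #|inner|.
  rewrite card_sig -[n.+1 in LHS]card_ord -(cardsC [set ord0; ord_max]) cards2.
  rewrite -val_eqE /= eq_sym -lt0n ltnW // addKn.
  by apply: eq_card => v; rewrite !inE.
apply/box_representableP.
exists (fun v A => (left_end (val v) (val A))%:R%R).
exists (fun v A => (right_end (val v) (val A))%:R%R).
have card2 (A : kneser n.+1 2) : #|val A| = 2 := eqP (valP A).
split=> [v A|A B AB]; first by rewrite ler_nat left_leq_right.
rewrite kneser_adjE //; apply/idP/forallP => [disj v|meet].
  rewrite !ler_nat (disjoint_left_leq_right _ n_gt2 (card2 A) (card2 B) disj).
  rewrite disjoint_sym in disj.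
  exact: disjoint_left_leq_right n_gt2 (card2 B) (card2 A) disj.
apply: contraT => AB_meet.
have [v v_inner] := meeting_ends_disjoint (ltnW n_gt2) (card2 A) (card2 B) AB AB_meet.
by have := meet (Sub v v_inner); rewrite !ler_nat /= !ltnNge => /andP[-> ->].
Qed.

Theorem theorem1 (R : realType) :
  (forall n : nat, 5 <= n -> boxicity R (kneser n 2) = n - 2) /\
  boxicity R (kneser 5 2) = 3.
Proof.
have boxicity_kneser2 n : 5 <= n -> boxicity R (kneser n 2) = n - 2.
  move=> n_gt4; rewrite /boxicity; case: ex_minnP => d /asboolP repr d_min.
  apply/eqP; rewrite eqn_leq leq_subLR addnC.
  rewrite (kneser2_box_representable_geq n_gt4 repr) andbT.
  by apply: d_min; apply/asboolP/kneser2_box_representable; apply: leq_trans n_gt4.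
by split; [exact: boxicity_kneser2 | exact: (boxicity_kneser2 5)].
Qed.
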